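(* The triple $\mathbb{M} := (M,\delta,\kappa)$, consisting of the functor $M:\mathbf{BornMeas}\to\mathbf{BornMeas}$ of finite signed measures of bounded support, the Dirac measure maps $\delta_X:X\to MX$, and the maps $\kappa_X:MMX\to MX$ given by $(\kappa_X(\mathcal{M}))(E)=\int \mathrm{Ev}_E\,d\mathcal{M}$, is a monad on the category $\mathbf{BornMeas}$ of measurable bornological sets.
   Context: A bornology on a set $X$ is a collection $\mathcal{B}X$ of subsets of $X$ (the bounded subsets) that is closed under taking subsets and finite unions (in particular contains $\emptyset$) and contains all singletons. A measurable bornological set is a set equipped with both a bornology and a sigma-algebra (no compatibility is required). $\mathbf{BornMeas}$ is the category of measurable bornological sets with maps that are measurable and bornological (images of bounded sets are bounded). $\mathbb{R}$ carries its Borel sigma-algebra and usual bornology. A subset $A\subseteq X$ carries the sigma-algebra $\{A\cap E\mid E\subseteq X \text{ measurable}\}$ and the bornology of those subsets of $A$ that are bounded in $X$. For a measurable space $X$, $SX$ is the real vector space (setwise operations) of all finite signed measures on $X$, with the sigma-algebra generated by the evaluation maps $\mathrm{Ev}_E:SX\to\mathbb{R}$, $\mu\mapsto\mu(E)$ ($E\subseteq X$ measurable), and with the total variation norm $\|\mu\|=|\mu|(X)$. For $f:X\to Y$ measurable, $Sf:SX\to SY$ is the direct image map, $(Sf(\mu))(F)=\mu(f^{-1}(F))$. For an arbitrary subset $A\subseteq X$ with inclusion $\iota_{AX}:A\hookrightarrow X$, $\mu\in SX$ is supported by $A$ if $\mu=S\iota_{AX}(\nu)$ for some $\nu\in SA$.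 A function is $\mu$-integrable, for $\mu$ signed, if it is integrable with respect to $|\mu|$. For $X\in\mathbf{BornMeas}$: $MX$ is the set of all $\mu\in SX$ of bounded support, i.e. supported by some bounded $B\subseteq X$. It carries the sigma-algebra induced from $SX$ (i.e. generated by the maps $\mathrm{Ev}_E:MX\to\mathbb{R}$) and the supportwise bornology, i.e. the bornology consisting of all subsets of the sets $M(B,X,\gamma):=\{\mu\in MX\mid \mu\text{ is supported by }B\text{ and }\|\mu\|\leqslant\gamma\}$ with $B\subseteq X$ bounded and $\gamma\geqslant 0$ real. For $f:X\to Y$ in $\mathbf{BornMeas}$, $Mf:MX\to MY$ is the restriction of $Sf$. The map $\delta_X:X\to MX$ sends $x$ to the Dirac measure $\delta_x$. The map $\kappa_X:MMX\to MX$ sends $\mathcal{M}\in MMX$ to the measure $\kappa_X(\mathcal{M})$ given by $(\kappa_X(\mathcal{M}))(E)=\int\mathrm{Ev}_E\,d\mathcal{M}$ for $E\subseteq X$ measurable, where $\mathrm{Ev}_E:MX\to\mathbb{R}$. *)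

(* Defs.v *)
From HB Require Import structures.
From mathcomp Require Import all_boot all_order all_algebra.
From mathcomp Require Import all_classical all_reals all_analysis.

Set Implicit Arguments.
Unset Strict Implicit.
Unset Printing Implicit Defensive.

Import Order.TTheory GRing.Theory Num.Theory.
Import numFieldNormedType.Exports.

Local Open Scope classical_set_scope.
Local Open Scope ring_scope.

Record category := Category {
  obj :> Type;
  mor : obj -> obj -> Type;
  idm : forall X, mor X X;
  compm : forall X Y Z, mor Y Z -> mor X Y -> mor X Z;
  comp1m : forall X Y (f : mor X Y), compm (idm Y) f = f;
  compm1 : forall X Y (f : mor X Y), compm f (idm X) = f;
  compmA : forall X Y Z W (h : mor Z W) (g : mor Y Z) (f : mor X Y),
    compm h (compm g f) = compm (compm h g) f }.

Arguments mor {c}.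
Arguments idm {c}.
Arguments compm {c X Y Z}.

Section monads.
Variable C : category.
Implicit Types T : C -> C.

Definition is_functor T (fmap : forall X Y, mor X Y -> mor (T X) (T Y)) :=
  (forall X, fmap X X (idm X) = idm (T X)) /\
  (forall X Y Z (g : mor Y Z) (f : mor X Y),
     fmap X Z (compm g f) = compm (fmap Y Z g) (fmap X Y f)).

Record is_monad T (fmap : forall X Y, mor X Y -> mor (T X) (T Y))
    (unit : forall X, mor X (T X)) (mult : forall X, mor (T (T X)) (T X))
    : Prop := IsMonad {
  monad_functor : is_functor fmap;
  monad_unit_natural : forall X Y (f : mor X Y),
    compm (unit Y) f = compm (fmap X Y f) (unit X);
  monad_mult_natural : forall X Y (f : mor X Y),
    compm (mult Y) (fmap _ _ (fmap X Y f)) = compm (fmap X Y f) (mult X);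
  monad_assoc : forall X,
    compm (mult X) (fmap _ _ (mult X)) = compm (mult X) (mult (T X));
  monad_unitl : forall X, compm (mult X) (unit (T X)) = idm (T X);
  monad_unitr : forall X, compm (mult X) (fmap _ _ (unit X)) = idm (T X) }.

End monads.

(* [measurableType] is pointed, which would exclude the empty set both as an
   object and as a possible support, hence this structure. *)
Record measSpace := MeasSpace {
  ms_carrier :> Type;
  msets : set (set ms_carrier);
  msetsP : sigma_algebra setT msets }.

Arguments msets : clear implicits.

Definition measurable_map (X Y : measSpace) (f : X -> Y) :=
  forall F, msets Y F -> msets X (f @^-1` F).

Definition ms_sub (X : measSpace) (A : set X) : measSpace :=
  @MeasSpace A (preimage_set_system setT (@set_val X A) (msets X))
    (sigma_algebra_preimage setT set_val (msetsP X)).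

Lemma measurable_set_val (X : measSpace) (A : set X) :
  measurable_map (X := ms_sub A) (@set_val X A).
Proof. by move=> F mF; exists F => //; rewrite setTI. Qed.

Section measSpace_theory.
Variable X : measSpace.

Lemma msets0 : msets X set0. Proof. by case: (msetsP X). Qed.

Lemma msetsC E : msets X E -> msets X (~` E).
Proof. by case: (msetsP X) => _ + _ mE => /(_ _ mE); rewrite setTD. Qed.

Lemma msets_bigcup (F : (set X)^nat) :
  (forall n, msets X (F n)) -> msets X (\bigcup_n F n).
Proof. by case: (msetsP X) => _ _; exact. Qed.

End measSpace_theory.

(* A point is needed only to view a measurable space as a [measurableType],
   e.g. to integrate on it; it plays no other role. *)
Definition pointed_ms (X : measSpace) (x0 : X) : Type := X.

Section pointed_ms.
Variables (X : measSpace) (x0 : X).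
HB.instance Definition _ := gen_eqMixin (pointed_ms x0).
HB.instance Definition _ := gen_choiceMixin (pointed_ms x0).
HB.instance Definition _ := isPointed.Build (pointed_ms x0) x0.
HB.instance Definition _ := @isMeasurable.Build default_measure_display
  (pointed_ms x0) (msets X) (@msets0 X) (@msetsC X) (@msets_bigcup X).
End pointed_ms.

Lemma msetsD (X : measSpace) (A B : set X) :
  msets X A -> msets X B -> msets X (A `\` B).
Proof.
have [->|/set0P[x0 _]] := eqVneq A set0.
  by rewrite set0D => _ _; exact: msets0.
exact: (@measurableD _ (pointed_ms x0)).
Qed.

Lemma msetsI (X : measSpace) (A B : set X) :
  msets X A -> msets X B -> msets X (A `&` B).
Proof.
move=> mA mB; rewrite -[B]setCK -setDE; apply: msetsD => //; exact: msetsC.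
Qed.

Section signed_measure.
Variables (R : realType) (X : measSpace).

Definition countably_additive (mu : set X -> R) :=
  forall F : (set X)^nat, (forall n, msets X (F n)) -> trivIset setT F ->
    \sum_(0 <= i < n) mu (F i) @[n --> \oo] --> mu (\bigcup_n F n).

(* The value 0 off the sigma-algebra is a normalization: it makes equality of
   signed measures coincide with equality on measurable sets. *)
Record signed_measure := SignedMeasure {
  sm_fun :> set X -> R;
  sm_sigma_additive : countably_additive sm_fun;
  sm_out : forall E, ~ msets X E -> sm_fun E = 0 }.

Definition restr_msets (mu : set X -> R) : set X -> R :=
  fun E => if `[< msets X E >] then mu E else 0.

Lemma restr_msetsE mu E : msets X E -> restr_msets mu E = mu E.
Proof. by move=> /asboolP mE; rewrite /restr_msets mE. Qed.

Lemma restr_msets_out mu E : ~ msets X E -> restr_msets mu E = 0.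
Proof. by move=> /asboolPn/negbTE mE; rewrite /restr_msets mE. Qed.

Lemma restr_msets_additive mu :
  countably_additive mu -> countably_additive (restr_msets mu).
Proof.
move=> mua F mF tF; rewrite restr_msetsE; last exact: msets_bigcup.
under eq_fun do under eq_bigr do rewrite restr_msetsE//.
exact: mua.
Qed.

Definition mk_signed_measure mu (mua : countably_additive mu) :=
  SignedMeasure (restr_msets_additive mua) (@restr_msets_out mu).

Lemma signed_measure_ext (mu nu : signed_measure) :
  (forall E, msets X E -> mu E = nu E) -> mu = nu.
Proof.
move=> h; have : sm_fun mu = sm_fun nu.
  apply/funext => E; have [/h//|nE] := pselect (msets X E).
  by rewrite !sm_out.
move: mu nu {h} => [m ma m0] [n na n0] /= mn; subst n.
by congr SignedMeasure; exact: Prop_irrelevance.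
Qed.

Lemma czero_additive : countably_additive (fun=> 0).
Proof.
move=> F _ _; under eq_fun do rewrite big1//.
exact: cvg_cst.
Qed.

Definition sm_zero := mk_signed_measure czero_additive.

End signed_measure.

Section direct_image.
Variables (R : realType) (X Y : measSpace) (f : X -> Y).

Lemma direct_image_additive (mu : signed_measure R X) :
  measurable_map f -> countably_additive (fun F => mu (f @^-1` F)).
Proof.
move=> mf F mF tF; rewrite preimage_bigcup.
apply: (@sm_sigma_additive _ _ mu (fun n => f @^-1` F n)).
- by move=> n; exact: mf.
- apply/trivIsetP => i j _ _ ij; rewrite -preimage_setI.
  move/trivIsetP : tF => /(_ _ _ Logic.I Logic.I ij) ->.
  by rewrite preimage_set0.
Qed.

Definition direct_image (mf : measurable_map f) (mu : signed_measure R X) :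
  signed_measure R Y := mk_signed_measure (@direct_image_additive mu mf).

End direct_image.

Definition supported (R : realType) (X : measSpace) (mu : signed_measure R X)
    (A : set X) :=
  exists nu : signed_measure R (ms_sub A),
    mu = direct_image (@measurable_set_val X A) nu.

Section variation.
Variables (R : realType) (X : measSpace).
Implicit Type mu : signed_measure R X.

Lemma signed_measure0 mu : mu set0 = 0.
Proof.
have t0 : trivIset setT (fun _ : nat => set0 : set X).
  by apply/trivIsetP => *; rewrite set0I.
have := @sm_sigma_additive _ _ mu _ (fun=> @msets0 X) t0.
rewrite bigcup0// => cv.
have cvS : \sum_(0 <= i < n.+1) mu set0 @[n --> \oo] --> mu set0.
  by move: cv; rewrite -(cvg_shiftS _ (nbhs (mu set0))).
have := cvgB cvS cv; rewrite subrr => cv0'.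
have cv0 : (fun=> mu set0) @ \oo --> (0 : R).
  rewrite (_ : (fun=> mu set0) = (fun n => \sum_(0 <= i < n.+1) mu set0) \-
    (fun n => \sum_(0 <= i < n) mu set0)); first exact: cv0'.
  apply/funext => n /=.
  by rewrite big_nat_recr//= addrAC subrr add0r.
exact: (cvg_unique (@Rhausdorff R) (cvg_cst _) cv0).
Qed.

Lemma countably_additive_EFin (x0 : X) (mu : set X -> R) :
  countably_additive mu ->
  semi_sigma_additive ((fun E => (mu E)%:E) : set (pointed_ms x0) -> \bar R).
Proof.
move=> mua F mF tF _; under eq_fun do rewrite sumEFin.
by apply: cvg_EFin; [exact: nearW|exact: mua].
Qed.

Section charge_of_signed_measure.
Variables (x0 : X) (mu : signed_measure R X).

Definition charge_of_signed_measure : set (pointed_ms x0) -> \bar R :=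
  fun E => (mu E)%:E.

Let charge0 : charge_of_signed_measure set0 = 0%E.
Proof. by rewrite /charge_of_signed_measure signed_measure0. Qed.

Let charge_finite E : measurable E -> charge_of_signed_measure E \is a fin_num.
Proof. by []. Qed.

HB.instance Definition _ := isCharge.Build _ _ _ charge_of_signed_measure
  charge0 charge_finite
  (countably_additive_EFin (@sm_sigma_additive _ _ mu)).

End charge_of_signed_measure.

Definition is_hahn_set mu (P : set X) :=
  [/\ msets X P,
      forall E, msets X E -> E `<=` P -> 0 <= mu E &
      forall E, msets X E -> E `<=` ~` P -> mu E <= 0].

Lemma ex_hahn_set mu : exists P, is_hahn_set mu P.
Proof.
have [X0|/set0P[x0 _]] := eqVneq [set: X] set0.
  have E0 (E : set X) : E = set0 by rewrite -subset0 -X0.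
  exists set0; split => [|E _ _|E _ _]; first exact: msets0.
    by rewrite (E0 E) signed_measure0.
  by rewrite (E0 E) signed_measure0.
have [P [N [[mP posP] [_ negN] PN PN0]]] :=
  Hahn_decomposition (@charge_of_signed_measure x0 mu).
exists P; split=> [||E mE EP]; [exact: mP|exact: posP|rewrite -lee_fin].
apply: (negN E mE) => x /EP nPx.
by have [] : (P `|` N) x by rewrite PN.
Qed.

Definition hahn_set mu : set X := sval (cid (ex_hahn_set mu)).

Lemma hahn_setP mu : is_hahn_set mu (hahn_set mu).
Proof. exact: (svalP (cid (ex_hahn_set mu))). Qed.

(* Jordan decomposition; on measurable sets it does not depend on the choice
   of the Hahn set. Off the sigma-algebra the values are irrelevant. *)
Definition pos_part mu (E : set X) : R := mu (E `&` hahn_set mu).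

Definition neg_part mu (E : set X) : R := - mu (E `\` hahn_set mu).

Definition sm_variation mu (E : set X) : R := pos_part mu E + neg_part mu E.

Definition sm_norm mu : R := sm_variation mu setT.

Lemma pos_part_ge0 mu E : 0 <= pos_part mu E.
Proof.
rewrite /pos_part; have [mP posP _] := hahn_setP mu.
have [mE|nE] := pselect (msets X (E `&` hahn_set mu)); last by rewrite sm_out.
by apply: posP => // x [].
Qed.

Lemma neg_part_ge0 mu E : 0 <= neg_part mu E.
Proof.
rewrite /neg_part oppr_ge0; have [mP _ negN] := hahn_setP mu.
have [mE|nE] := pselect (msets X (E `\` hahn_set mu)); last by rewrite sm_out.
by apply: negN => // x [].
Qed.

Lemma pos_part_additive mu : countably_additive (pos_part mu).
Proof.
move=> F mF tF; rewrite /pos_part setI_bigcupl.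
have [mP _ _] := hahn_setP mu.
apply: (@sm_sigma_additive _ _ mu (fun n => F n `&` hahn_set mu)).
  by move=> n; exact: msetsI.
exact: trivIset_setIr.
Qed.

Lemma neg_part_additive mu : countably_additive (neg_part mu).
Proof.
move=> F mF tF; rewrite /neg_part setDE setI_bigcupl.
have [mP _ _] := hahn_setP mu.
under eq_fun do rewrite sumrN; apply: cvgN.
apply: (@sm_sigma_additive _ _ mu (fun n => F n `&` ~` hahn_set mu)).
  by move=> n; rewrite -setDE; exact: msetsD.
exact: trivIset_setIr.
Qed.

Lemma sm_variation_additive mu : countably_additive (sm_variation mu).
Proof.
move=> F mF tF; under eq_fun do rewrite big_split.
by apply: cvgD; [exact: pos_part_additive|exact: neg_part_additive].
Qed.

Lemma sm_variation_ge0 mu E : 0 <= sm_variation mu E.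
Proof. by rewrite addr_ge0 ?pos_part_ge0 ?neg_part_ge0. Qed.

End variation.

Section integral.
Variables (R : realType) (X : measSpace) (x0 : X) (mu : signed_measure R X).

Definition pos_measure : set (pointed_ms x0) -> \bar R :=
  fun E => (pos_part mu E)%:E.

Definition neg_measure : set (pointed_ms x0) -> \bar R :=
  fun E => (neg_part mu E)%:E.

Definition variation_measure : set (pointed_ms x0) -> \bar R :=
  fun E => (sm_variation mu E)%:E.

Let pos0 : pos_measure set0 = 0%E.
Proof. by rewrite /pos_measure /pos_part set0I signed_measure0. Qed.

Let pos_ge0 E : (0 <= pos_measure E)%E.
Proof. by rewrite lee_fin pos_part_ge0. Qed.

HB.instance Definition _ := isMeasure.Build _ _ _ pos_measure
  pos0 pos_ge0 (countably_additive_EFin (@pos_part_additive R X mu)).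

Let neg0 : neg_measure set0 = 0%E.
Proof. by rewrite /neg_measure /neg_part set0D signed_measure0 oppr0. Qed.

Let neg_ge0 E : (0 <= neg_measure E)%E.
Proof. by rewrite lee_fin neg_part_ge0. Qed.

HB.instance Definition _ := isMeasure.Build _ _ _ neg_measure
  neg0 neg_ge0 (countably_additive_EFin (@neg_part_additive R X mu)).

Let variation0 : variation_measure set0 = 0%E.
Proof.
rewrite /variation_measure EFinD -/(pos_measure _) -/(neg_measure _).
by rewrite pos0 neg0 adde0.
Qed.

Let variation_ge0 E : (0 <= variation_measure E)%E.
Proof. by rewrite lee_fin sm_variation_ge0. Qed.

HB.instance Definition _ := isMeasure.Build _ _ _ variation_measure
  variation0 variation_ge0
  (countably_additive_EFin (@sm_variation_additive R X mu)).

Definition signed_integrable (f : X -> R) :=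
  variation_measure.-integrable [set: pointed_ms x0] (fun x => (f x)%:E).

Definition signed_integral (f : X -> R) : R :=
  \int[pos_measure]_x f x - \int[neg_measure]_x f x.

End integral.

Definition bornology (T : Type) (B : set (set T)) :=
  [/\ forall A A', A `<=` A' -> B A' -> B A,
      B set0,
      forall A A', B A -> B A' -> B (A `|` A') &
      forall x, B [set x]].

Record bornMeas := BornMeas {
  bm_ms :> measSpace;
  bounded : set (set bm_ms);
  boundedP : bornology bounded }.

Arguments bounded : clear implicits.

Record bornMeas_hom (X Y : bornMeas) := BornMeasHom {
  bm_fun :> X -> Y;
  bm_measurable : measurable_map bm_fun;
  bm_bornological : forall A, bounded X A -> bounded Y (bm_fun @` A) }.

Lemma bornMeas_hom_ext (X Y : bornMeas) (f g : bornMeas_hom X Y) :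
  f =1 g -> f = g.
Proof.
move: f g => [f mf bf] [g mg bg] /= /funext fg; subst g.
by congr BornMeasHom; exact: Prop_irrelevance.
Qed.

Lemma bornological_id (X : bornMeas) A : bounded X A -> bounded X (idfun @` A).
Proof. by rewrite image_id. Qed.

Definition bornMeas_id (X : bornMeas) : bornMeas_hom X X :=
  @BornMeasHom X X idfun (fun _ => id) (@bornological_id X).

Section comp.
Variables (X Y Z : bornMeas) (g : bornMeas_hom Y Z) (f : bornMeas_hom X Y).

Lemma measurable_map_comp : measurable_map (g \o f).
Proof. by move=> F mF; rewrite comp_preimage; do 2!apply: bm_measurable. Qed.

Lemma bornological_comp A : bounded X A -> bounded Z ((g \o f) @` A).
Proof. by move=> bA; rewrite -image_comp; do 2!apply: bm_bornological. Qed.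

Definition bornMeas_comp : bornMeas_hom X Z :=
  BornMeasHom measurable_map_comp bornological_comp.

End comp.

Definition bornMeasCat : category := @Category bornMeas bornMeas_hom
  bornMeas_id bornMeas_comp
  (fun X Y f => @bornMeas_hom_ext X Y
     (bornMeas_comp (bornMeas_id Y) f) f (fun=> erefl))
  (fun X Y f => @bornMeas_hom_ext X Y
     (bornMeas_comp f (bornMeas_id X)) f (fun=> erefl))
  (fun X Y Z W h g f => @bornMeas_hom_ext X W
     (bornMeas_comp h (bornMeas_comp g f))
     (bornMeas_comp (bornMeas_comp h g) f) (fun=> erefl)).

Section bounded_support.
Variables (R : realType) (X : bornMeas).

Record bsMeasure := BsMeasure {
  bs_sm :> signed_measure R X;
  bs_supp : exists2 B, bounded X B & supported bs_sm B }.

Lemma bsMeasure_ext (mu nu : bsMeasure) :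
  (forall E, msets X E -> mu E = nu E) -> mu = nu.
Proof.
move: mu nu => [m sm] [n sn] /= /signed_measure_ext mn; subst n.
by congr BsMeasure; exact: Prop_irrelevance.
Qed.

Lemma bs_zero_supp : exists2 B, bounded X B & supported (sm_zero R X) B.
Proof.
exists set0; first by case: (boundedP X).
exists (sm_zero R _); apply: signed_measure_ext => E mE /=.
rewrite !restr_msetsE//; exact: measurable_set_val.
Qed.

Definition bs_zero : bsMeasure := BsMeasure bs_zero_supp.

Definition bs_msets : set (set bsMeasure) :=
  <<s \bigcup_(E in msets X)
        preimage_set_system setT (fun mu : bsMeasure => mu E)
          (@measurable _ R) >>.

Definition bs_ms : measSpace := MeasSpace (smallest_sigma_algebra setT _ :
  sigma_algebra setT bs_msets).

Definition bs_ball (B : set X) (gamma : R) : set bsMeasure :=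
  [set mu | supported mu B /\ sm_norm mu <= gamma].

Definition bs_bounded : set (set bsMeasure) :=
  [set A | exists B gamma,
    [/\ bounded X B, 0 <= gamma & A `<=` bs_ball B gamma]].

Lemma supported_subset (mu : signed_measure R X) (A B : set X) :
  A `<=` B -> supported mu A -> supported mu B.
Proof.
move=> AB [nu ->].
pose i (a : A) : B := SigSub (mem_set (AB _ (set_valP a))).
have mi : measurable_map (X := ms_sub A) (Y := ms_sub B) i.
  move=> _ [E mE <-]; exists E => //.
exists (direct_image mi nu); apply: signed_measure_ext => E mE /=.
rewrite !restr_msetsE//; exact: measurable_set_val.
Qed.

Lemma bs_boundedP : bornology bs_bounded.
Proof.
have [_ b0 bU _] := boundedP X.
split.
- move=> A A' AA' [B [g [bB g0 A'B]]]; exists B, g; split => //.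
  exact: subset_trans A'B.
- by exists set0, 0; split.
- move=> A A' [B [g [bB g0 AB]]] [B' [g' [bB' g'0 AB']]].
  exists (B `|` B'), (Num.max g g'); split; first exact: bU.
    by rewrite le_max g0.
  move=> mu [/AB|/AB'] [smu nmu]; split.
  + by apply: supported_subset smu; exact: subsetUl.
  + by rewrite le_max nmu.
  + by apply: supported_subset smu; exact: subsetUr.
  + by rewrite le_max nmu orbT.
- move=> mu; have [B bB sB] := bs_supp mu.
  exists B, (sm_norm mu); split => //; first exact: sm_variation_ge0.
  by move=> _ ->; split.
Qed.

Definition bsMeasureSpace : bornMeas := @BornMeas bs_ms bs_bounded bs_boundedP.

End bounded_support.

(* Main.v *)
Require Import Defs.
From HB Require Import structures.
From mathcomp Require Import all_boot all_order all_algebra.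
From mathcomp Require Import all_classical all_reals all_analysis.
From mathcomp Require Import measurable_realfun lra.

(** Every law of the monad is an identity between integrals, and all of them
    follow from three rules: change of variables
    ([signed_integral_direct_image]), integration against a Dirac measure
    ([signed_integral_dirac]) and integration against an average of measures
    ([signed_integral_join]). Indeed, applied to the evaluations at measurable
    sets, change of variables gives the naturality of [kappa] and the unit law
    that involves the image of [delta]; the Dirac rule is the other unit law;
    and the rule for averages, combined with change of variables, is
    associativity.

    Each rule is immediate for indicator functions. A measurable function is a
    pointwise limit of step functions dominated by it ([step_approx]), and
    dominated convergence applies because everything is bounded where it
    matters: a measure of bounded support ignores all that happens outside a
    bounded set, and the evaluations are bounded on bounded sets of measures by
    the norm. The same approximation shows that the integral depends measurably
    on the measure, which makes [kappa] measurable.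

    Supports are arbitrary subsets, in general not measurable. They enter only
    through [supportedP]: being supported by [A] means vanishing on the
    measurable sets that miss [A]. Thus a measurable condition that holds on a
    support holds almost everywhere. Likewise the total variation enters only
    through [sm_norm_le], the bound of [mu E - mu (~` E)] for all measurable
    [E]. With these two criteria the bornological estimates are short: direct
    images do not increase the norm, and if [MM] is supported by a set of
    measures which are supported by [B] and have norm at most [g], then the
    average is supported by [B] and has norm at most [g] times the norm of
    [MM]. *)

Set Implicit Arguments.
Unset Strict Implicit.
Unset Printing Implicit Defensive.

Import Order.TTheory GRing.Theory Num.Theory.
Import numFieldNormedType.Exports.

Local Open Scope classical_set_scope.
Local Open Scope ring_scope.

(** * Supports and norms of signed measures *)

Section measSpace_extra.
Variable X : measSpace.
Implicit Types A B : set X.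

Lemma msetsU A B : msets X A -> msets X B -> msets X (A `|` B).
Proof.
move=> mA mB; rewrite -[_ `|` _]setCK setCU.
by apply/msetsC/msetsI; exact: msetsC.
Qed.

Lemma msets_setT : msets X setT.
Proof. by rewrite -setC0; apply/msetsC/msets0. Qed.

Lemma msets_bigsetU (F : (set X)^nat) n :
  (forall i, msets X (F i)) -> msets X (\big[setU/set0]_(i < n) F i).
Proof. by move=> mF; elim/big_ind: _ => //; [exact: msets0|exact: msetsU]. Qed.

End measSpace_extra.

Section signed_measure_extra.
Variables (R : realType) (X : measSpace).
Implicit Types (mu : signed_measure R X) (A E F : set X).

Lemma signed_measureU mu E F : msets X E -> msets X F -> E `&` F = set0 ->
  mu (E `|` F) = mu E + mu F.
Proof.
have [->|/set0P[x0 _] mE mF EF] := eqVneq E set0.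
  by rewrite set0U signed_measure0 add0r.
apply: EFin_inj.
exact: (chargeU (@charge_of_signed_measure R X x0 mu) mE mF EF).
Qed.

Lemma signed_measure_split mu E F : msets X E -> msets X F ->
  mu E = mu (E `&` F) + mu (E `\` F).
Proof.
move=> mE mF; rewrite -signed_measureU ?setUIDK//; first exact: msetsI.
- exact: msetsD.
- by rewrite -subset0 => x [[_ Fx] [_ /(_ Fx)]].
Qed.

(** The criterion lets supports be checked without ever building a measure on
    the subspace. Conversely, if [mu] vanishes on measurable sets that miss
    [A], then [mu E] depends only on the trace of [E] on [A], because two
    measurable sets with the same trace differ by sets that miss [A]; hence the
    rule sending the trace of [E] to [mu E] is a measure on [A]. *)
Lemma supportedP mu A :
  supported mu A <-> forall E, msets X E -> E `&` A = set0 -> mu E = 0.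
Proof.
split=> [[nu ->] E mE EA|mu0].
  rewrite /= restr_msetsE// (_ : _ @^-1` E = set0) ?signed_measure0//.
  rewrite -subset0 => -[x xA] /= Ex.
  suff : (E `&` A) x by rewrite EA.
  by split=> //; exact: set_mem.
pose iA := @set_val X A.
have traceE E F : msets X E -> msets X F -> iA @^-1` E = iA @^-1` F ->
    mu E = mu F.
  move=> mE mF EF; have dis G H : iA @^-1` G = iA @^-1` H ->
      (G `\` H) `&` A = set0.
    move=> GH; rewrite -subset0 => x [[Gx nHx] Ax]; apply: nHx.
    suff : (iA @^-1` H) (SigSub (mem_set Ax)) by [].
    by rewrite -GH.
  rewrite (signed_measure_split mu mE mF) (signed_measure_split mu mF mE).
  rewrite [F `&` E]setIC; congr (_ + _).
  rewrite (mu0 (E `\` F)) ?(mu0 (F `\` E))//; do ?exact: msetsD.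
    by apply: dis; rewrite EF.
  exact: dis.
pose nu (G : set (ms_sub A)) : R :=
  if pselect (exists2 E, msets X E & iA @^-1` E = G) is left h
  then mu (s2val (cid2 h)) else 0.
have nuE E : msets X E -> nu (iA @^-1` E) = mu E.
  move=> mE; rewrite /nu; case: pselect => [h|[]]; last by exists E.
  by case: (cid2 h) => E' mE' /= E'E; exact: traceE.
have nua : countably_additive (X := ms_sub A) nu.
  move=> F mF tF.
  have /choice[E EF] : forall n, exists E, msets X E /\ iA @^-1` E = F n.
    by move=> n; have [E mE <-] := mF n; exists E; rewrite setTI.
  have mDE n : msets X (seqDU E n).
    apply: msetsD; first exact: (EF n).1.
    by apply: msets_bigsetU => i; exact: (EF i).1.
  have DEF n : iA @^-1` (seqDU E n) = F n.
    apply/seteqP; split=> x /=; rewrite -(EF n).2; first by case.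
    move=> Enx; split=> //; rewrite -bigcup_mkord => -[k /= kn Ekx].
    have kEn : k = n.
      by apply: tF => //; exists x; split; rewrite -(EF _).2.
    by rewrite kEn ltnn in kn.
  have -> : \bigcup_n F n = iA @^-1` (\bigcup_n seqDU E n).
    by rewrite preimage_bigcup; apply: eq_bigcupr => n _.
  (* The [E n] may overlap outside [A]; their successive differences [seqDU]
     are disjoint and have the same traces. *)
  rewrite nuE; last exact: msets_bigcup.
  under eq_fun do under eq_bigr do rewrite -DEF nuE//.
  by apply: sm_sigma_additive => //; exact: trivIset_seqDU.
exists (mk_signed_measure nua); apply: signed_measure_ext => E mE.
by rewrite /= !restr_msetsE ?nuE//; exact: measurable_set_val.
Qed.

Lemma supported_setT mu : supported mu setT.
Proof.
by apply/supportedP => E _; rewrite setIT => ->; rewrite signed_measure0.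
Qed.

Lemma sm_normE mu :
  sm_norm mu = mu (hahn_set mu) - mu (~` hahn_set mu).
Proof. by rewrite /sm_norm /sm_variation /pos_part /neg_part setTI setTD. Qed.

(** A Hahn set maximizes [mu E - mu (~` E)], and the maximum is the total
    variation. This bounds norms by testing one set at a time, with no
    reference to the Hahn sets of the images and integrals of [mu], which have
    no explicit description. *)
Lemma sm_norm_le mu g :
  sm_norm mu <= g <-> forall E, msets X E -> mu E - mu (~` E) <= g.
Proof.
rewrite sm_normE; have [mP posP negP] := hahn_setP mu.
set P := hahn_set mu in mP posP negP *; split=> [h E mE|]; last exact.
apply: le_trans h.
have mCP := msetsC mP; have mCE := msetsC mE.
have PE0 : 0 <= mu (P `\` E) by apply: posP; [exact: msetsD|move=> ? []].
have EP0 : mu (E `\` P) <= 0 by apply: negP; [exact: msetsD|move=> ? []].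
rewrite (signed_measure_split mu mE mP) (signed_measure_split mu mP mE).
rewrite (signed_measure_split mu mCE mCP) (signed_measure_split mu mCP mCE).
have CD (U V : set X) : ~` U `\` ~` V = V `\` U by rewrite !setDE setCK setIC.
rewrite !CD [P `&` E]setIC [~` P `&` _]setIC.
lra.
Qed.

(** Both Jordan parts inherit the null sets of a support, so that what holds on
    a support, measurable or not, can be used almost everywhere. *)
Lemma jordan_null mu A E : supported mu A -> msets X E ->
  E `&` A = set0 -> pos_part mu E = 0 /\ neg_part mu E = 0.
Proof.
move=> /supportedP mu0 mE EA; have [mP _ _] := hahn_setP mu.
rewrite /pos_part /neg_part !mu0 ?oppr0//.
- exact: msetsD.
- by rewrite setDE setIAC EA set0I.
- exact: msetsI.
- by rewrite setIAC EA set0I.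
Qed.

End signed_measure_extra.

Section direct_image_extra.
Variables (R : realType) (X Y : measSpace) (f : X -> Y).
Variable mf : measurable_map f.
Implicit Type mu : signed_measure R X.

Lemma direct_imageE mu F : msets Y F -> direct_image mf mu F = mu (f @^-1` F).
Proof. exact: restr_msetsE. Qed.

Lemma supported_direct_image mu A :
  supported mu A -> supported (direct_image mf mu) (f @` A).
Proof.
move=> /supportedP mu0; apply/supportedP => F mF FA.
rewrite direct_imageE// mu0//; first exact: mf.
rewrite -subset0 => x [Ffx Ax]; suff : (F `&` f @` A) (f x) by rewrite FA.
by split=> //; exists x.
Qed.

Lemma sm_norm_direct_image mu : sm_norm (direct_image mf mu) <= sm_norm mu.
Proof.
apply/sm_norm_le => F mF; rewrite !direct_imageE//; last exact: msetsC.
by move/sm_norm_le : (lexx (sm_norm mu)) => /(_ _ (mf mF)).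
Qed.

End direct_image_extra.

(** * Real measurable functions on a space without base point *)

Section real_measurable.
Variable R : realType.

Definition real_measurable (Y : measSpace) (h : Y -> R) :=
  forall F, measurable F -> msets Y (h @^-1` F).

Lemma real_measurableP (Y : measSpace) (y0 : Y) (h : Y -> R) :
  real_measurable h <-> measurable_fun [set: pointed_ms y0] h.
Proof.
split=> [mh _ F mF|mh F mF]; first by rewrite setTI; exact: mh.
by rewrite -[_ @^-1` _]setTI; exact: (mh measurableT F mF).
Qed.

(** A base point may be assumed: a preimage without points is measurable. *)
Lemma real_measurable_pointwise (Y : measSpace) (h : Y -> R) :
  (forall y0, measurable_fun [set: pointed_ms y0] h) -> real_measurable h.
Proof.
move=> mh F mF; have [->|/set0P[y0 _]] := eqVneq (h @^-1` F) set0.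
  exact: msets0.
exact: (real_measurableP y0 h).2.
Qed.

Lemma real_measurable_comp (Y Z : measSpace) (f : Y -> Z) (h : Z -> R) :
  measurable_map f -> real_measurable h -> real_measurable (h \o f).
Proof. by move=> mf mh F mF; rewrite comp_preimage; exact/mf/mh. Qed.

Lemma real_measurable_indic (Y : measSpace) (E : set Y) :
  msets Y E -> real_measurable (\1_E : Y -> R).
Proof.
by move=> mE; apply: real_measurable_pointwise => y0;
  exact: (@measurable_indic _ (pointed_ms y0)).
Qed.

Lemma real_measurable_ev (X : bornMeas) (E : set X) : msets X E ->
  real_measurable (Y := bs_ms R X) (fun mu : bsMeasure R X => mu E).
Proof.
move=> mE F mF; apply: sub_gen_smallest.
by exists E => //; exists F => //; rewrite setTI.
Qed.

(** The sets whose preimage is measurable form a sigma-algebra, so only the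
    generators of the sigma-algebra, which come from evaluations, matter. *)
Lemma measurable_map_bs (Y : measSpace) (X : bornMeas) (f : Y -> bsMeasure R X) :
  (forall E, msets X E -> real_measurable (fun y => f y E)) ->
  measurable_map (Y := bs_ms R X) f.
Proof.
move=> mf F; suff: msets (bs_ms R X) `<=` image_set_system setT f (msets Y).
  by move=> h /h; rewrite /image_set_system /= setTI.
apply: smallest_sub.
  by apply: sigma_algebra_image; apply: msetsP.
move=> _ [E mE [G mG <-]]; rewrite /image_set_system /= !setTI.
exact: mf.
Qed.

End real_measurable.

(** * Integrals of functions bounded on a support *)

Section integral_bounded_on.
Context d (T : measurableType d) (R : realType) (m : {measure set T -> \bar R}).
Hypothesis m_fin : (m setT < +oo)%E.
Variable A : set T.
Hypothesis m_null : forall E, measurable E -> E `&` A = set0 -> m E = 0%E.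
Implicit Types (h : T -> R) (c : R).

(** [A] need not be measurable, which is why the property has to be: then its
    failure set is a measurable set that misses [A]. *)
Lemma ae_carrier (P : set T) :
  measurable P -> A `<=` P -> {ae m, forall x, P x}.
Proof.
move=> mP AP; exists (~` P); split=> //; first exact: measurableC.
apply: m_null; first exact: measurableC.
by rewrite -subset0 => x [nPx /AP].
Qed.

Lemma measurable_norm_le h c : measurable_fun setT h ->
  measurable [set x | `|h x| <= c].
Proof.
move=> mh; rewrite [X in measurable X](_ : _ =
  setT `&` (Num.norm \o h) @^-1` `]-oo, c]%classic).
  by apply: measurableT_comp => //; exact: measurable_itv.
by rewrite setTI; apply/seteqP; split=> x /=; rewrite in_itv.
Qed.

Lemma integrable_cst_fin c : m.-integrable setT (EFin \o cst c).
Proof.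
apply/integrableP; split; first exact/measurable_EFinP/measurable_cst.
by rewrite (integral_cst m measurableT `|c|%:E) lte_mul_pinfty.
Qed.

Lemma integrable_bounded_on h c : measurable_fun setT h ->
  (forall x, A x -> `|h x| <= c) -> m.-integrable setT (EFin \o h).
Proof.
move=> mh hc; apply/integrableP; split; first exact/measurable_EFinP.
apply: (@le_lt_trans _ _ (\int[m]_x (`|c|%:E))%E).
  apply: ae_ge0_le_integral => //.
    by do 2 apply: measurableT_comp => //.
  have : {ae m, forall x, [set x | `|h x| <= c] x}.
    by apply: ae_carrier => //; exact: measurable_norm_le.
  apply: filterS => x /= hx _; rewrite lee_fin.
  exact: le_trans (ler_norm _).
by rewrite integral_cst// lte_mul_pinfty.
Qed.

(** Dominated convergence, dominated by a constant that bounds the sequence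
    only on the support. *)
Lemma cvg_Rintegral_bounded_on (h_ : nat -> T -> R) h c :
    (forall n, measurable_fun setT (h_ n)) -> measurable_fun setT h ->
    (forall n x, A x -> `|h_ n x| <= c) ->
    (forall x, h_ n x @[n --> \oo] --> h x) ->
  \int[m]_x h_ n x @[n --> \oo] --> \int[m]_x h x.
Proof.
move=> mh_ mh hc h_h.
have ih n := integrable_bounded_on (mh_ n) (hc n).
have [||||| ihh _ cv] := @dominated_convergence _ _ _ m setT measurableT
    (fun n x => (h_ n x)%:E) (EFin \o h) (EFin \o cst c).
- by move=> n; exact/measurable_EFinP.
- exact/measurable_EFinP.
- apply: aeW => x _; apply: cvg_EFin; [exact: nearW|exact: h_h].
- exact: integrable_cst_fin.
- have : {ae m, forall x, (\bigcap_n [set x | `|h_ n x| <= c]) x}.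
      apply: ae_carrier; last by move=> x Ax n _; exact: hc.
      by apply: bigcap_measurable => [|n _]; [exists 0%N|exact: measurable_norm_le].
    by apply: filterS => x hx n _; rewrite lee_fin; exact: hx.
apply: fine_cvg; rewrite fineK//; exact: integrable_fin_num ihh.
Qed.

Lemma normr_Rintegral_bounded_on h c : 0 <= c -> measurable_fun setT h ->
  (forall x, A x -> `|h x| <= c) ->
  `|\int[m]_x h x| <= c * fine (m setT).
Proof.
move=> c0 mh hc; have ih := integrable_bounded_on mh hc.
apply: le_trans (le_normr_Rintegral _ _) _ => //.
rewrite -(Rintegral_cst m measurableT c).
apply: fine_le.
- by apply: integrable_fin_num => //; exact: integrable_abse ih.
- by apply: integrable_fin_num => //; exact: integrable_cst_fin.
apply: ae_ge0_le_integral => //.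
  by do 2 apply: measurableT_comp => //.
have : {ae m, forall x, [set x | `|h x| <= c] x}.
  by apply: ae_carrier => //; exact: measurable_norm_le.
by apply: filterS => x /= hx _; rewrite lee_fin.
Qed.

End integral_bounded_on.

Section signed_integral_theory.
Variables (R : realType) (Z : measSpace) (z0 : Z).
Implicit Types (mu : signed_measure R Z) (A : set Z) (h : Z -> R) (c : R).

Let pos mu := @pos_measure R Z z0 mu.
Let neg mu := @neg_measure R Z z0 mu.
Let var mu := @variation_measure R Z z0 mu.

Lemma pos_measure_null mu A : supported mu A ->
  forall E, msets Z E -> E `&` A = set0 -> pos mu E = 0%E.
Proof.
by move=> sA E mE EA; rewrite /pos /pos_measure (jordan_null sA mE EA).1.
Qed.

Lemma neg_measure_null mu A : supported mu A ->
  forall E, msets Z E -> E `&` A = set0 -> neg mu E = 0%E.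
Proof.
by move=> sA E mE EA; rewrite /neg /neg_measure (jordan_null sA mE EA).2.
Qed.

Lemma variation_measure_null mu A : supported mu A ->
  forall E, msets Z E -> E `&` A = set0 -> var mu E = 0%E.
Proof.
move=> sA E mE EA; rewrite /var /variation_measure /sm_variation.
by have [-> ->] := jordan_null sA mE EA; rewrite addr0.
Qed.

Lemma signed_integrable_bounded_on mu A h c : supported mu A ->
  real_measurable h -> (forall z, A z -> `|h z| <= c) ->
  signed_integrable z0 mu h.
Proof.
move=> sA /(real_measurableP z0) mh hc.
exact: (integrable_bounded_on (m := var mu) (ltry _)
  (variation_measure_null sA) mh hc).
Qed.

Lemma cvg_signed_integral mu A (h_ : nat -> Z -> R) h c : supported mu A ->
    (forall n, real_measurable (h_ n)) -> real_measurable h ->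
    (forall n z, A z -> `|h_ n z| <= c) ->
    (forall z, h_ n z @[n --> \oo] --> h z) ->
  signed_integral z0 mu (h_ n) @[n --> \oo] --> signed_integral z0 mu h.
Proof.
move=> sA mh_ /(real_measurableP z0) mh hc h_h.
have {}mh_ n := (real_measurableP z0 (h_ n)).1 (mh_ n).
apply: cvgB.
- exact: (cvg_Rintegral_bounded_on (m := pos mu) (ltry _)
    (pos_measure_null sA) mh_ mh hc h_h).
- exact: (cvg_Rintegral_bounded_on (m := neg mu) (ltry _)
    (neg_measure_null sA) mh_ mh hc h_h).
Qed.

Lemma normr_signed_integral mu A h c : 0 <= c -> supported mu A ->
  real_measurable h -> (forall z, A z -> `|h z| <= c) ->
  `|signed_integral z0 mu h| <= c * sm_norm mu.
Proof.
move=> c0 sA /(real_measurableP z0) mh hc.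
apply: le_trans (ler_normB _ _) _; rewrite /sm_norm /sm_variation mulrDr.
apply: lerD.
- exact: (normr_Rintegral_bounded_on (m := pos mu) (ltry _)
    (pos_measure_null sA) c0 mh hc).
- exact: (normr_Rintegral_bounded_on (m := neg mu) (ltry _)
    (neg_measure_null sA) c0 mh hc).
Qed.

(** The family is indexed by an arbitrary type, with hypotheses for every index
    and not only those of [s], so that no membership in [s] is ever needed. *)
Lemma signed_integral_sum mu A (I : Type) (s : seq I) (a : I -> R)
    (g : I -> Z -> R) : supported mu A ->
    (forall i, real_measurable (g i)) ->
    (forall i, exists c, forall z, A z -> `|g i z| <= c) ->
  signed_integral z0 mu (fun z => \sum_(i <- s) a i * g i z) =
  \sum_(i <- s) a i * signed_integral z0 mu (g i).
Proof.
move=> sA mg bg.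
have sumE (m : {measure set (pointed_ms z0) -> \bar R}) :
    (forall i, m.-integrable setT (EFin \o g i)) ->
    \int[m]_z (\sum_(i <- s) a i * g i z) = \sum_(i <- s) a i * \int[m]_z g i z.
  move=> ig; have iag i : m.-integrable setT (EFin \o (fun z => a i * g i z)).
    exact: (integrableZl measurableT (a i) (ig i)).
  elim: s => [|i s IH].
    under eq_Rintegral do rewrite big_nil.
    by rewrite big_nil Rintegral_cst// mul0r.
  under eq_Rintegral do rewrite big_cons.
  rewrite RintegralD// ?IH ?big_cons ?RintegralZl//.
  rewrite (_ : EFin \o _ = (fun z => \sum_(j <- s) (a j * g j z)%:E)%E).
    by apply: integrable_sum => // j _; exact: iag.
  by apply/funext => z; rewrite /= sumEFin.
have mg' i := (real_measurableP z0 (g i)).1 (mg i).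
rewrite /signed_integral !sumE.
- by rewrite -sumrB; apply: eq_bigr => i _; rewrite mulrBr.
- move=> i; have [c gc] := bg i.
  exact: (integrable_bounded_on (m := neg mu) (ltry _)
    (neg_measure_null sA) (mg' i) gc).
- move=> i; have [c gc] := bg i.
  exact: (integrable_bounded_on (m := pos mu) (ltry _)
    (pos_measure_null sA) (mg' i) gc).
Qed.

Lemma signed_integralB mu A f g : supported mu A ->
    real_measurable f -> real_measurable g ->
    (exists c, forall z, A z -> `|f z| <= c) ->
    (exists c, forall z, A z -> `|g z| <= c) ->
  signed_integral z0 mu (fun z => f z - g z) =
  signed_integral z0 mu f - signed_integral z0 mu g.
Proof.
move=> sA mf mg bf bg.
have := @signed_integral_sum mu A bool [:: true; false]
  (fun b => if b then 1 else -1) (fun b => if b then f else g) sA.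
rewrite !big_cons big_nil /= mul1r mulN1r addr0 => <-; [|by case..].
by congr signed_integral; apply/funext => z;
  rewrite !big_cons big_nil /= mul1r mulN1r addr0.
Qed.

Lemma signed_integral_indic mu E : msets Z E ->
  signed_integral z0 mu (\1_E) = mu E.
Proof.
move=> mE; have [mP _ _] := hahn_setP mu.
have indicE (m : {measure set (pointed_ms z0) -> \bar R}) :
    \int[m]_z \1_E z = fine (m E).
  rewrite /Rintegral; congr fine.
  by have := @integral_indic _ (pointed_ms z0) R m setT measurableT E mE;
    rewrite setIT.
rewrite /signed_integral !indicE /= (signed_measure_split mu mE mP).
by rewrite /pos_part /neg_part opprK.
Qed.

End signed_integral_theory.

(** * Approximation by step functions *)

Section step_functions.
Variables (R : realType) (Z : measSpace).
Implicit Types (mu : signed_measure R Z) (A : set Z) (h : Z -> R) (c : R).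

(** Formal step functions. They are kept apart from the functions that they
    denote because the same list is both evaluated at points and, through
    [step_sum], integrated against measures that vary with the argument.
    Measurability is packed with each set, so that it is available for every
    entry. *)
Definition steps := seq (R * {E : set Z | msets Z E}).
Implicit Type l : steps.

Definition step_fun l (z : Z) : R := \sum_(p <- l) p.1 * \1_(sval p.2) z.

Definition step_sum l (mu : set Z -> R) : R := \sum_(p <- l) p.1 * mu (sval p.2).

Definition step_opp l : steps := [seq (- p.1, p.2) | p <- l].

Lemma step_fun_cat l l' z : step_fun (l ++ l') z = step_fun l z + step_fun l' z.
Proof. by rewrite /step_fun big_cat. Qed.

Lemma step_fun_opp l z : step_fun (step_opp l) z = - step_fun l z.
Proof.
by rewrite /step_fun big_map -sumrN; apply: eq_bigr => p _; rewrite mulNr.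
Qed.

Lemma real_measurable_step l : real_measurable (step_fun l).
Proof.
apply: real_measurable_pointwise => z0; apply: measurable_sum => p.
apply: measurable_funM => //.
exact: (@measurable_indic _ (pointed_ms z0) R setT _ (svalP p.2)).
Qed.

Import HBNNSimple.

Lemma step_approx_ge0 (z0 : Z) h : real_measurable h -> (forall z, 0 <= h z) ->
  exists l : nat -> steps,
    (forall z, step_fun (l n) z @[n --> \oo] --> h z) /\
    (forall n z, 0 <= step_fun (l n) z <= h z).
Proof.
move=> /(real_measurableP z0)/measurable_EFinP mh h0.
pose g := nnsfun_approx measurableT mh.
have mg n (y : R) : msets Z ((g n : pointed_ms z0 -> R) @^-1` [set y]).
  exact: (@measurable_funPTI _ _ (pointed_ms z0) R (g n) [set y] (measurable_set1 y)).
pose l n : steps := [seq (y, exist _ _ (mg n y)) |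
  y <- finmap.enum_fset (fset_set (range (g n)))].
have lE n z : step_fun (l n) z = g n z.
  rewrite (fimfunE (g n) z) fsbig_finite; last exact: fimfunP.
  by rewrite /step_fun big_map.
have cg z : g n z @[n --> \oo] --> h z.
  have hE0 (x : pointed_ms z0) : [set: pointed_ms z0] x ->
    (0 <= (EFin \o h) x)%E by rewrite lee_fin.
  exact: (fine_cvg (cvg_nnsfun_approx measurableT mh hE0 (x := z) Logic.I)).
exists l; split=> [z|n z].
  by under eq_fun do rewrite lE; exact: cg.
rewrite lE; apply/andP; split; first exact: fun_ge0.
rewrite -(cvg_lim _ (cg z))//.
apply: (nondecreasing_cvgn_le (u_ := fun n => g n z)).
  by move=> i j ij; have /lefP/(_ z) := nd_nnsfun_approx measurableT mh ij.
by apply/cvg_ex; exists (h z).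
Qed.

(** The approximants depend on [h] alone and not on a measure: a single
    sequence computes the integral of [h] against all measures for which [h] is
    bounded on a support. This makes the integral a pointwise limit of
    combinations of evaluations. The domination by [h] keeps the approximants
    bounded on these supports. *)
Lemma step_approx (z0 : Z) h : real_measurable h ->
  exists l : nat -> steps,
    (forall z, step_fun (l n) z @[n --> \oo] --> h z) /\
    (forall n z, `|step_fun (l n) z| <= `|h z|).
Proof.
move=> mh; have [mhP] := real_measurableP z0 h; move=> _.
have mh' := mhP mh.
(* positive and negative parts of [h] *)
have [||lp [cp bp]] := @step_approx_ge0 z0 (fun z => Num.max (h z) 0).
- by apply/(real_measurableP z0); apply: measurable_maxr => //.
- by move=> z; rewrite le_max lexx orbT.
have [||lm [cm bm]] := @step_approx_ge0 z0 (fun z => Num.max (- h z) 0).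
- by apply/(real_measurableP z0); apply: measurable_maxr => //; exact: measurableT_comp.
- by move=> z; rewrite le_max lexx orbT.
exists (fun n => lp n ++ step_opp (lm n)); split=> [z|n z].
  under eq_fun do rewrite step_fun_cat step_fun_opp.
  have -> : h z = Num.max (h z) 0 - Num.max (- h z) 0.
    case: (ler0P (h z)) => hz.
      by rewrite (max_idPl _) ?oppr_ge0// sub0r opprK.
    by rewrite (max_idPr _) ?oppr_le0 ?(ltW hz)// subr0.
  exact: cvgB.
rewrite step_fun_cat step_fun_opp.
move: (bm n z) (bp n z); set a := step_fun _ z; set b := step_fun _ z.
rewrite ler_norml; case: (ler0P (h z)) => hz.
  rewrite (max_idPl _) ?oppr_ge0// => /andP[a0 ah] /andP[b0 bh].
  by apply/andP; split; lra.
rewrite (max_idPr _) ?oppr_le0 ?(ltW hz)// => /andP[a0 ah] /andP[b0 bh].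
by apply/andP; split; lra.
Qed.

Lemma signed_integral_step (z0 : Z) mu l :
  signed_integral z0 mu (step_fun l) = step_sum l mu.
Proof.
rewrite (signed_integral_sum z0 l (fun p => p.1) (g := fun p => \1_(sval p.2))
  (supported_setT mu)).
- by apply: eq_bigr => p _; rewrite signed_integral_indic//; exact: svalP.
- by move=> p; apply: real_measurable_indic; exact: svalP.
- by move=> p; exists 1 => z _; rewrite ger0_norm.
Qed.

Lemma cvg_step_sum (z0 : Z) mu A h c (l : nat -> steps) : supported mu A ->
    real_measurable h -> (forall z, A z -> `|h z| <= c) ->
    (forall z, step_fun (l n) z @[n --> \oo] --> h z) ->
    (forall n z, `|step_fun (l n) z| <= `|h z|) ->
  step_sum (l n) mu @[n --> \oo] --> signed_integral z0 mu h.
Proof.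
move=> sA mh hc lh lb.
under eq_fun do rewrite -(signed_integral_step z0).
apply: (@cvg_signed_integral _ _ z0 mu A (fun n => step_fun (l n)) h c) => //.
- by move=> n; exact: real_measurable_step.
- by move=> n z Az; apply: le_trans (hc z Az).
Qed.

End step_functions.

(** Change of variables. Signed integrals are defined through the Jordan
    decomposition, which direct images do not preserve, since positive and
    negative mass may cancel; so the formula cannot be applied to each part.
    It is clear for indicators, and step approximation extends it to [h]. *)
Lemma signed_integral_direct_image (R : realType) (X Z : measSpace) (x0 : X)
    (z0 : Z) (f : X -> Z) (mf : measurable_map f) (mu : signed_measure R X)
    (A : set X) (h : Z -> R) (c : R) :
    supported mu A -> real_measurable h -> (forall x, A x -> `|h (f x)| <= c) ->
  signed_integral z0 (direct_image mf mu) h = signed_integral x0 mu (h \o f).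
Proof.
move=> sA mh hc; have [l [lh lb]] := step_approx z0 mh.
have lim1 : step_sum (l n) (direct_image mf mu) @[n --> \oo] -->
    signed_integral z0 (direct_image mf mu) h.
  apply: (@cvg_step_sum _ _ z0 _ (f @` A) h c) => //.
    exact: supported_direct_image.
  by move=> _ [x Ax <-]; exact: hc.
have lim2 : signed_integral x0 mu (step_fun (l n) \o f) @[n --> \oo] -->
    signed_integral x0 mu (h \o f).
  apply: (@cvg_signed_integral _ _ x0 mu A (fun n => step_fun (l n) \o f)
    (h \o f) c) => //.
  - by move=> n; apply: real_measurable_comp => //; exact: real_measurable_step.
  - exact: real_measurable_comp.
  - by move=> n x Ax; apply: le_trans (hc x Ax); exact: lb.
  - by move=> x; exact: lh.
apply: (cvg_unique (@Rhausdorff R) lim1).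
suff -> : (fun n => step_sum (l n) (direct_image mf mu)) =
  (fun n => signed_integral x0 mu (step_fun (l n) \o f)) by [].
apply/funext => n.
have mE (p : R * {E : set Z | msets Z E}) : msets X (f @^-1` sval p.2).
  exact/mf/svalP.
rewrite (_ : step_fun (l n) \o f =
  fun x => \sum_(p <- l n) p.1 * \1_(f @^-1` sval p.2) x); last first.
  by apply/funext => x; apply: eq_bigr => p _; rewrite !indicE -!topredE.
rewrite (signed_integral_sum x0 (l n) (fun p => p.1)
  (g := fun p => \1_(f @^-1` sval p.2)) sA).
- apply: eq_bigr => p _.
  by rewrite signed_integral_indic// direct_imageE//; exact: svalP.
- by move=> p; exact: real_measurable_indic.
- by move=> p; exists 1 => x _; rewrite ger0_norm.
Qed.

(** * Direct images and Dirac measures as maps of bornological spaces *)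

Section bounded_support_measures.
Variable R : realType.
Implicit Types X Y : bornMeas.

Lemma normr_le_sm_norm (X : measSpace) (mu : signed_measure R X) (E : set X) :
  `|mu E| <= sm_norm mu.
Proof.
have [mE|nE] := pselect (msets X E); last first.
  by rewrite sm_out// normr0 sm_variation_ge0.
have le (F : set X) : msets X F -> mu F - mu (~` F) <= sm_norm mu.
  exact: (sm_norm_le mu (sm_norm mu)).1.
have := le _ mE; have := le _ (msetsC mE); have := le _ (msets_setT X).
have := le _ (msets0 X).
rewrite setCK setCT setC0 signed_measure0.
have -> : mu setT = mu E + mu (~` E).
  by rewrite (signed_measure_split mu (msets_setT X) mE) setTI setTD.
by move=> ? ? ? ?; rewrite ler_norml; apply/andP; split; lra.
Qed.

(** Such functions are integrable for every measure of bounded support. *)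
Definition real_bornological (Y : bornMeas) (h : Y -> R) :=
  forall B, bounded Y B -> exists2 c, 0 <= c & forall y, B y -> `|h y| <= c.

Lemma real_bornological_ev X (E : set X) :
  real_bornological (Y := bsMeasureSpace R X) (fun mu : bsMeasure R X => mu E).
Proof.
move=> C [B [g [_ g0 CB]]]; exists g => // mu /CB[_].
exact: le_trans (normr_le_sm_norm _ _).
Qed.

Lemma real_measurable_step_sum Y (l : steps R Y) :
  real_measurable (Y := bs_ms R Y) (fun mu : bsMeasure R Y => step_sum l mu).
Proof.
apply/(real_measurableP (Y := bs_ms R Y) (bs_zero R Y)).
apply: measurable_sum => p; apply: measurable_funM => //.
apply/(real_measurableP (Y := bs_ms R Y) (bs_zero R Y)).
by apply: real_measurable_ev; exact: svalP.
Qed.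

(** Integration against a fixed [h] is a pointwise limit of the measurable
    functions [step_sum (l n)] of the measure. *)
Lemma real_measurable_signed_integral Y (y0 : Y) (h : Y -> R) :
    real_measurable h -> real_bornological h ->
  real_measurable (Y := bs_ms R Y)
    (fun mu : bsMeasure R Y => signed_integral y0 mu h).
Proof.
move=> mh bh; have [l [lh lb]] := step_approx y0 mh.
apply/(real_measurableP (Y := bs_ms R Y) (bs_zero R Y)).
apply: (@measurable_fun_cvg _ (@pointed_ms (bs_ms R Y) (bs_zero R Y)) R setT
  (fun n (mu : bsMeasure R Y) => step_sum (l n) mu)).
  move=> n; apply/(real_measurableP (Y := bs_ms R Y) (bs_zero R Y)).
  exact: real_measurable_step_sum.
move=> mu _; have [B /bh[c _ hc] sB] := bs_supp mu.
exact: cvg_step_sum sB mh hc lh lb.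
Qed.

Section bs_map.
Variables (X Y : bornMeas) (f : bornMeas_hom X Y).

Lemma bs_map_supp (mu : bsMeasure R X) : exists2 B, bounded Y B &
  supported (direct_image (@bm_measurable X Y f) mu) B.
Proof.
have [B bB sB] := bs_supp mu; exists (f @` B); first exact: bm_bornological.
exact: supported_direct_image.
Qed.

Definition bs_map_fun (mu : bsMeasure R X) : bsMeasure R Y :=
  BsMeasure (bs_map_supp mu).

Lemma bs_map_measurable :
  measurable_map (X := bs_ms R X) (Y := bs_ms R Y) bs_map_fun.
Proof.
apply: (measurable_map_bs (Y := bs_ms R X)) => E mE.
have -> : (fun mu => bs_map_fun mu E) =
    (fun mu : bsMeasure R X => mu (f @^-1` E)).
  by apply/funext => mu; exact: direct_imageE.
by apply: real_measurable_ev; apply: bm_measurable.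
Qed.

Lemma bs_map_bornological A : bs_bounded A -> bs_bounded (bs_map_fun @` A).
Proof.
move=> [B [g [bB g0 AB]]]; exists (f @` B), g; split=> //.
  exact: bm_bornological.
move=> _ [mu /AB[sB ng] <-]; split; first exact: supported_direct_image.
exact: le_trans (sm_norm_direct_image _ _) ng.
Qed.

Definition bs_map : bornMeas_hom (bsMeasureSpace R X) (bsMeasureSpace R Y) :=
  @BornMeasHom (bsMeasureSpace R X) (bsMeasureSpace R Y) bs_map_fun
    bs_map_measurable bs_map_bornological.

End bs_map.

Section bs_dirac.
Variable X : bornMeas.

Lemma dirac_additive (x : X) :
  @countably_additive R X (fun E => \1_E x).
Proof.
move=> F mF tF; apply: cvg_near_cst.
have [[n _ Fnx]|nF] := pselect ((\bigcup_n F n) x); last first.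
  apply: nearW => n; rewrite indicE memNset// big1// => i _.
  by rewrite indicE memNset// => Fix; apply: nF; exists i.
rewrite indicE mem_set; last by exists n.
exists n.+1 => // m /= nm.
rewrite big_mkord (bigD1 (Ordinal nm))//= indicE mem_set// big1 ?addr0// => i.
move=> /eqP ne; rewrite indicE memNset// => Fix; apply: ne; apply: val_inj => /=.
by apply: tF => //; exists x.
Qed.

Lemma supported_dirac (x : X) :
  supported (mk_signed_measure (@dirac_additive x)) [set x].
Proof.
apply/supportedP => E mE Ex; rewrite /= restr_msetsE// indicE memNset// => xE.
by suff : (E `&` [set x]) x by rewrite Ex.
Qed.

Lemma bs_dirac_supp (x : X) : exists2 B, bounded X B &
  supported (mk_signed_measure (@dirac_additive x)) B.
Proof.
by exists [set x]; [case: (boundedP X)|exact: supported_dirac].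
Qed.

Definition bs_dirac_fun (x : X) : bsMeasure R X := BsMeasure (bs_dirac_supp x).

Lemma bs_dirac_funE x E : msets X E -> bs_dirac_fun x E = \1_E x.
Proof. exact: restr_msetsE. Qed.

Lemma bs_dirac_measurable : measurable_map (Y := bs_ms R X) bs_dirac_fun.
Proof.
apply: measurable_map_bs => E mE.
under eq_fun do rewrite bs_dirac_funE//.
exact: real_measurable_indic.
Qed.

Lemma bs_dirac_bornological A : bounded X A -> bs_bounded (bs_dirac_fun @` A).
Proof.
move=> bA; exists A, 1; split=> // _ [x Ax <-]; split.
  by apply: (supported_subset _ (@supported_dirac x)) => _ ->.
apply/sm_norm_le => E mE.
by have mCE := msetsC mE; rewrite !bs_dirac_funE.
Qed.

Definition bs_dirac : bornMeas_hom X (bsMeasureSpace R X) :=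
  @BornMeasHom X (bsMeasureSpace R X) bs_dirac_fun
    bs_dirac_measurable bs_dirac_bornological.

End bs_dirac.

End bounded_support_measures.

(** * The averaging map *)

Section bs_join.
Variables (R : realType) (X : bornMeas).
Notation MX := (bsMeasureSpace R X).
Notation ev E := (fun mu : bsMeasure R X => mu E).
Notation integral := (signed_integral (X := bs_ms R X) (bs_zero R X)).
Implicit Type MM : bsMeasure R MX.

Let bs_ev_bounded (BB : set (bsMeasure R X)) : bs_bounded BB ->
  forall E, exists c, forall mu, BB mu -> `|mu E| <= c.
Proof. by move=> bBB E; have [c _ hc] := real_bornological_ev E bBB; exists c. Qed.

(** Evaluations at the partial unions converge pointwise, and they are bounded
    by the norms, hence uniformly on a bounded support of [MM]. *)
Lemma join_additive MM : countably_additive (fun E => integral MM (ev E)).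
Proof.
move=> F mF tF.
have [BB bBB sBB] := bs_supp MM; have [B [g [_ g0 BBB]]] := bBB.
have mev E : msets X E -> real_measurable (Y := bs_ms R X) (ev E).
  exact: (@real_measurable_ev R X E).
have sumE n : \sum_(0 <= i < n) integral MM (ev (F i)) =
    integral MM (fun mu : bsMeasure R X => \sum_(0 <= i < n) 1 * mu (F i)).
  rewrite (signed_integral_sum (Z := bs_ms R X) (bs_zero R X)
    (index_iota 0 n) (fun=> 1) (g := fun i => ev (F i)) sBB).
  - by apply: eq_bigr => i _; rewrite mul1r.
  - by move=> i; apply: mev.
  - by move=> i; apply: bs_ev_bounded.
under eq_fun do rewrite sumE.
have finE n (mu : bsMeasure R X) :
    \sum_(0 <= i < n) 1 * mu (F i) = mu (\big[setU/set0]_(i < n) F i).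
  elim: n => [|n IH]; first by rewrite big_nil big_ord0 signed_measure0.
  rewrite big_nat_recr// big_ord_recr/= IH mul1r signed_measureU//.
    exact: msets_bigsetU.
  rewrite -bigcup_mkord -subset0 => x [[k /= kn Fkx] Fnx].
  have kEn : k = n by apply: tF => //; exists x.
  by rewrite kEn ltnn in kn.
apply: (@cvg_signed_integral R (bs_ms R X) (bs_zero R X) MM BB
  (fun n (mu : bsMeasure R X) => \sum_(0 <= i < n) 1 * mu (F i)) _ g) => //.
- move=> n; under eq_fun do rewrite finE.
  by apply: mev; exact: msets_bigsetU.
- by apply: mev; exact: msets_bigcup.
- move=> n mu /BBB[_ ng]; rewrite finE.
  exact: le_trans (normr_le_sm_norm _ _) ng.
- move=> mu; under eq_fun do under eq_bigr do rewrite mul1r.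
  exact: sm_sigma_additive.
Qed.

(** The measure is the mean of the measures on [X] that are distributed by
    [MM]. *)
Definition join_measure MM := mk_signed_measure (@join_additive MM).

Lemma join_measureE MM E : msets X E ->
  join_measure MM E = integral MM (ev E).
Proof. exact: restr_msetsE. Qed.

(** The evaluation at a set that misses [B] vanishes on [BB], so its integral is
    at most zero times the norm of [MM]. *)
Lemma supported_join MM (BB : set (bsMeasure R X)) (B : set X) g :
    supported (X := bs_ms R X) MM BB -> BB `<=` bs_ball B g ->
  supported (join_measure MM) B.
Proof.
move=> sBB BBB; apply/supportedP => E mE EB; rewrite join_measureE//.
apply/eqP; rewrite -normr_le0 -(mul0r (sm_norm MM)).
apply: (@normr_signed_integral R (bs_ms R X) (bs_zero R X) MM BB) => //.
  exact: real_measurable_ev.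
by move=> mu /BBB[/supportedP smu _]; rewrite smu// normr0.
Qed.

(** The difference of the evaluations at [E] and at its complement is bounded
    on [BB] by the norm, hence by [g], and integrating it multiplies the bound
    by the norm of [MM]. *)
Lemma sm_norm_join MM (BB : set (bsMeasure R X)) (B : set X) g : 0 <= g ->
    supported (X := bs_ms R X) MM BB -> BB `<=` bs_ball B g ->
  sm_norm (join_measure MM) <= g * sm_norm MM.
Proof.
move=> g0 sBB BBB; apply/sm_norm_le => E mE.
have mCE := msetsC mE; rewrite !join_measureE//.
have mev F : msets X F -> real_measurable (Y := bs_ms R X) (ev F).
  exact: (@real_measurable_ev R X F).
have evb F : exists c, forall mu : bsMeasure R X, BB mu -> `|mu F| <= c.
  by exists g => mu /BBB[_]; exact: le_trans (normr_le_sm_norm _ _).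
rewrite -(signed_integralB (Z := bs_ms R X) _ sBB (mev _ mE) (mev _ mCE)
  (evb _) (evb _)).
apply: le_trans (ler_norm _) _.
apply: (@normr_signed_integral R (bs_ms R X) (bs_zero R X) MM BB) => //.
  apply/(real_measurableP (Y := bs_ms R X) (bs_zero R X)).
  by apply: measurable_funB;
    apply/(real_measurableP (Y := bs_ms R X) (bs_zero R X)); exact: mev.
move=> mu /BBB[_ ng]; have le := (sm_norm_le mu (sm_norm mu)).1 (lexx _).
rewrite ler_norml; apply/andP; split; last exact: le_trans (le _ mE) ng.
rewrite lerNl opprB; apply: le_trans ng.
by have := le _ mCE; rewrite setCK.
Qed.

Lemma bs_join_supp MM :
  exists2 B, bounded X B & supported (join_measure MM) B.
Proof.
have [BB [B [g [bB _ BBB]]] sBB] := bs_supp MM.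
by exists B => //; exact: supported_join BBB.
Qed.

Definition bs_join_fun MM : bsMeasure R X := BsMeasure (bs_join_supp MM).

Lemma bs_join_funE MM E : msets X E -> bs_join_fun MM E = integral MM (ev E).
Proof. exact: join_measureE. Qed.

Lemma bs_join_measurable :
  measurable_map (X := bs_ms R MX) (Y := bs_ms R X) bs_join_fun.
Proof.
apply: (measurable_map_bs (Y := bs_ms R MX)) => E mE.
have -> : (fun MM => bs_join_fun MM E) = (fun MM => integral MM (ev E)).
  by apply/funext => MM; exact: bs_join_funE.
apply: real_measurable_signed_integral; first exact: real_measurable_ev.
exact: real_bornological_ev.
Qed.

Lemma bs_join_bornological A : bs_bounded A -> bs_bounded (bs_join_fun @` A).
Proof.
move=> [BB [g' [bBB g'0 ABB]]]; have [B [g [bB g0 BBB]]] := bBB.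
exists B, (g * g'); split=> //; first exact: mulr_ge0.
move=> _ [MM /ABB[sBB ng'] <-]; split; first exact: supported_join BBB.
apply: le_trans (sm_norm_join g0 sBB BBB) _.
exact: ler_wpM2l.
Qed.

Definition bs_join : bornMeas_hom (bsMeasureSpace R MX) MX :=
  @BornMeasHom (bsMeasureSpace R MX) MX bs_join_fun
    bs_join_measurable bs_join_bornological.

(** Iterated integration. For an evaluation [h] this is the associativity of
    the averaging map. It holds for indicators by construction; in general both
    sides are limits of the same combinations of evaluations, on the right by
    dominated convergence, as [step_sum (l n) mu] is bounded by [c * g] for
    [mu] in [BB]. *)
Lemma signed_integral_join (x0 : X) (h : X -> R) MM :
    real_measurable h -> real_bornological h ->
  signed_integral x0 (bs_join_fun MM) h =
  integral MM (fun mu : bsMeasure R X => signed_integral x0 mu h).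
Proof.
move=> mh bh; have [l [lh lb]] := step_approx x0 mh.
have [BB bBB sBB] := bs_supp MM; have [B [g [bB g0 BBB]]] := bBB.
have [c c0 hc] := bh _ bB.
have lim1 : step_sum (l n) (bs_join_fun MM) @[n --> \oo] -->
    signed_integral x0 (bs_join_fun MM) h.
  exact: (cvg_step_sum (supported_join sBB BBB) mh hc lh lb).
have lim2 : integral MM (fun mu : bsMeasure R X => step_sum (l n) mu)
    @[n --> \oo] -->
    integral MM (fun mu : bsMeasure R X => signed_integral x0 mu h).
  apply: (@cvg_signed_integral R (bs_ms R X) (bs_zero R X) MM BB
    (fun n (mu : bsMeasure R X) => step_sum (l n) mu) _ (c * g)) => //.
  - by move=> n; apply: real_measurable_step_sum.
  - exact: real_measurable_signed_integral.
  - move=> n mu /BBB[smu ng]; rewrite -(signed_integral_step x0).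
    apply: (le_trans (normr_signed_integral x0 c0 smu _ _)).
    + exact: real_measurable_step.
    + by move=> x Bx; apply: le_trans (hc x Bx).
    + exact: ler_wpM2l.
  - move=> mu; have [C /bh[c' _ hc'] sC] := bs_supp mu.
    exact: cvg_step_sum sC mh hc' lh lb.
apply: (cvg_unique (@Rhausdorff R) lim1).
suff -> : (fun n => step_sum (l n) (bs_join_fun MM)) =
  (fun n => integral MM (fun mu : bsMeasure R X => step_sum (l n) mu)) by [].
apply/funext => n.
rewrite (signed_integral_sum (Z := bs_ms R X) (bs_zero R X) (l n)
  (fun p => p.1) (g := fun p => ev (sval p.2)) sBB).
- by apply: eq_bigr => p _; rewrite bs_join_funE//; exact: svalP.
- by move=> p; apply: real_measurable_ev; exact: svalP.
- by move=> p; exact: bs_ev_bounded.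
Qed.

End bs_join.

Lemma signed_integral_dirac (R : realType) (X : bornMeas) (x0 x : X)
    (h : X -> R) : real_measurable h ->
  signed_integral x0 (bs_dirac_fun R x) h = h x.
Proof.
move=> mh; have [l [lh lb]] := step_approx x0 mh.
have sx : supported (bs_dirac_fun R x) [set x] by exact: supported_dirac.
have lim1 : step_sum (l n) (bs_dirac_fun R x) @[n --> \oo] -->
    signed_integral x0 (bs_dirac_fun R x) h.
  by apply: (cvg_step_sum (c := `|h x|) sx mh _ lh lb) => _ ->.
apply: (cvg_unique (@Rhausdorff R) lim1).
suff -> : (fun n => step_sum (l n) (bs_dirac_fun R x)) =
  (fun n => step_fun (l n) x) by exact: lh.
apply/funext => n; apply: eq_bigr => p _; rewrite bs_dirac_funE//.
exact: svalP.
Qed.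

(** * The monad *)

Theorem theorem9p1 (R : realType) :
  exists (Mmap : forall X Y : bornMeas, bornMeas_hom X Y ->
            bornMeas_hom (bsMeasureSpace R X) (bsMeasureSpace R Y))
         (delta : forall X : bornMeas, bornMeas_hom X (bsMeasureSpace R X))
         (kappa : forall X : bornMeas,
            bornMeas_hom (bsMeasureSpace R (bsMeasureSpace R X))
                         (bsMeasureSpace R X)),
    [/\ forall (X Y : bornMeas) (f : bornMeas_hom X Y) (mu : bsMeasure R X),
          bs_sm (Mmap X Y f mu) = direct_image (@bm_measurable X Y f) mu,
        forall (X : bornMeas) (x : X) (E : set X), msets X E ->
          bs_sm (delta X x) E = \1_E x,
        forall (X : bornMeas) (MM : bsMeasure R (bsMeasureSpace R X))
            (E : set X), msets X E ->
          signed_integrable (X := bs_ms R X) (bs_zero R X) MM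
              (fun mu : bsMeasure R X => mu E) /\
          bs_sm (kappa X MM) E =
            signed_integral (X := bs_ms R X) (bs_zero R X) MM
              (fun mu : bsMeasure R X => mu E) &
        is_monad (C := bornMeasCat) Mmap delta kappa].
Proof.
exists (bs_map R), (bs_dirac R), (bs_join R); split=> //.
- by move=> X x E mE; exact: bs_dirac_funE.
- move=> X MM E mE; split; last exact: bs_join_funE.
  have [BB bBB sBB] := bs_supp MM; have [c _ hc] := real_bornological_ev E bBB.
  apply: (signed_integrable_bounded_on (Z := bs_ms R X) _ sBB _ hc).
  exact: real_measurable_ev.
split.
- split=> [X|X Y Z g f]; apply: bornMeas_hom_ext => mu;
    apply: bsMeasure_ext => E mE; rewrite /= !restr_msetsE//.
  exact: bm_measurable.
- move=> X Y f; apply: bornMeas_hom_ext => x; apply: bsMeasure_ext => E mE.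
  by rewrite /= !restr_msetsE//; exact: bm_measurable.
- move=> X Y f; apply: bornMeas_hom_ext => MM; apply: bsMeasure_ext => E mE.
  have mfE := bm_measurable f mE.
  rewrite [RHS]restr_msetsE// [LHS]bs_join_funE// [RHS]bs_join_funE//.
  have [BB bBB sBB] := bs_supp MM.
  have [c _ hc] := real_bornological_ev (f @^-1` E) bBB.
  have evE : (fun mu : bsMeasure R Y => mu E) \o bs_map_fun f =
      (fun mu : bsMeasure R X => mu (f @^-1` E)).
    by apply/funext => mu; exact: restr_msetsE.
  rewrite -evE; apply: (signed_integral_direct_image (X := bs_ms R X)
    (Z := bs_ms R Y) (c := c) _ _ _ sBB).
    exact: real_measurable_ev.
  by move=> mu /hc; rewrite /= restr_msetsE.
- move=> X; apply: bornMeas_hom_ext => MMM; apply: bsMeasure_ext => E mE.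
  rewrite [LHS]bs_join_funE// [RHS]bs_join_funE//.
  rewrite (signed_integral_join (X := bsMeasureSpace R X)); last 2 first.
  + exact: real_measurable_ev.
  + exact: real_bornological_ev.
  have [BBB bBBB sBBB] := bs_supp MMM.
  have [c _ hc] := real_bornological_ev E (bs_join_bornological bBBB).
  have evE : (fun mu : bsMeasure R X => mu E) \o @bs_join_fun R X =
      (fun MM : bsMeasure R (bsMeasureSpace R X) =>
         signed_integral (X := bs_ms R X) (bs_zero R X) MM
           (fun mu : bsMeasure R X => mu E)).
    by apply/funext => MM; exact: bs_join_funE.
  rewrite -evE; apply: (signed_integral_direct_image
    (X := bs_ms R (bsMeasureSpace R X)) (Z := bs_ms R X) (c := c) _ _ _ sBBB).
    exact: real_measurable_ev.
  by move=> MM BMM; apply: hc; exists MM.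
- move=> X; apply: bornMeas_hom_ext => mu; apply: bsMeasure_ext => E mE.
  rewrite [LHS]bs_join_funE//.
  apply: (signed_integral_dirac (X := bsMeasureSpace R X)).
  exact: real_measurable_ev.
- move=> X; apply: bornMeas_hom_ext => mu; apply: bsMeasure_ext => E mE.
  (* integrating over [X] takes a base point, which a nonempty [E] provides *)
  have [->|/set0P[x0 _]] := eqVneq E set0; first by rewrite !signed_measure0.
  rewrite [LHS]bs_join_funE//.
  have evE : (fun mu : bsMeasure R X => mu E) \o @bs_dirac_fun R X = \1_E.
    by apply/funext => x; exact: bs_dirac_funE.
  rewrite [RHS](_ : _ = signed_integral x0 mu \1_E); last first.
    by rewrite signed_integral_indic.
  rewrite -evE; apply: (signed_integral_direct_image (X := X)
    (Z := bs_ms R X) (c := 1) x0 _ _ (supported_setT mu)).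
    exact: real_measurable_ev.
  by move=> x _; rewrite bs_dirac_funE// ger0_norm.
Qed.
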